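(* Up to isomorphism of hyperfields, there are exactly five hyperfields of order $3$.
   Context: A hyperoperation on a set $S$ is a map $\boxplus: S\times S\to 2^S\setminus\{\varnothing\}$; for non-empty $A,B\subseteq S$ put $A\boxplus B=\bigcup_{a\in A,b\in B}(a\boxplus b)$ (singletons are identified with their elements). It is commutative if $a\boxplus b=b\boxplus a$, and associative if $a\boxplus(b\boxplus c)=(a\boxplus b)\boxplus c$ for all $a,b,c$. All hyperoperations are assumed commutative. A hypergroup $(G,\boxplus,0)$ is a set with an associative hyperoperation such that: (1) $0\boxplus x=\{x\}$ for all $x$; (2) for every $x$ there is a unique element $-x$ with $0\in x\boxplus(-x)$; (3) $x\in y\boxplus z$ if and only if $z\in x\boxplus(-y)$. A hyperring is a tuple $(R,\odot,\boxplus,1,0)$ such that $(R,\odot,1)$ is a commutative monoid, $(R,\boxplus,0)$ is a commutative hypergroup, $0\odot x=x\odot 0=0$ for all $x$, and $a\odot(x\boxplus y)=(a\odot x)\boxplus(a\odot y)$ and $(x\boxplus y)\odot a=(x\odot a)\boxplus(y\odot a)$ for all $a,x,y$ (where $a\odot A=\{a\odot s: s\in A\}$, and similarly for $A\odot a$). A hyperfield is a hyperring with $0\ne1$ in which every nonzero element has a multiplicative inverse. The order of a finite hyperfield is the cardinality of its underlying set. A homomorphism of hyperfields $f:\mathbb{F}\to\mathbb{L}$ is a map with $f(0)=0$, $f(1)=1$, $f(xy)=f(x)f(y)$ and $f(x\boxplus_{\mathbb{F}}y)\subseteq f(x)\boxplus_{\mathbb{L}}f(y)$ for all $x,y$. An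 isomorphism is a homomorphism having a two-sided inverse that is also a homomorphism. *)

(* Defs.v *)
From mathcomp Require Import all_boot.
From mathcomp Require Import boolp classical_sets cardinality.

Set Implicit Arguments.
Unset Strict Implicit.
Unset Printing Implicit Defensive.

Local Open Scope classical_set_scope.
Local Open Scope card_scope.

Definition hyperop (T : Type) := T -> T -> set T.

Definition set_hyperop (T : Type) (add : hyperop T) (A B : set T) : set T :=
  \bigcup_(a in A) \bigcup_(b in B) add a b.

Record is_hypergroup (T : Type) (add : hyperop T) (zero : T) : Prop := {
  hyperadd_neq0 : forall x y, add x y !=set0;
  hyperaddC : forall x y, add x y = add y x;
  hyperaddA : forall x y z,
    set_hyperop add [set x] (add y z) = set_hyperop add (add x y) [set z];
  hyperadd0 : forall x, add zero x = [set x];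
  hyperopp_uniq : forall x, exists! y, add x y zero;
  (* [y'] ranges over the unique opposite [-y] of [y]. *)
  hyperadd_rev : forall x y z y', add y y' zero ->
    (add y z x <-> add x y' z) }.

Record is_hyperring (T : Type) (mul : T -> T -> T) (add : hyperop T)
    (one zero : T) : Prop := {
  hypermulA : associative mul;
  hypermulC : commutative mul;
  hypermul1 : left_id one mul;
  hyperring_add : is_hypergroup add zero;
  hypermul0l : left_zero zero mul;
  hypermul0r : right_zero zero mul;
  hypermulDr : forall a x y,
    [set mul a s | s in add x y] = add (mul a x) (mul a y);
  hypermulDl : forall a x y,
    [set mul s a | s in add x y] = add (mul x a) (mul y a) }.

Record is_hyperfield (T : Type) (mul : T -> T -> T) (add : hyperop T)
    (one zero : T) : Prop := {
  hyperfield_ring : is_hyperring mul add one zero;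
  hyperfield_neq01 : zero <> one;
  hyperfield_inv : forall x, x <> zero -> exists y, mul x y = one }.

Record hyperfield := Hyperfield {
  hf_sort :> Type;
  hf_mul : hf_sort -> hf_sort -> hf_sort;
  hf_add : hyperop hf_sort;
  hf_one : hf_sort;
  hf_zero : hf_sort;
  hf_axioms : is_hyperfield hf_mul hf_add hf_one hf_zero }.

Arguments hf_one : clear implicits.
Arguments hf_zero : clear implicits.

Definition has_order (F : hyperfield) (n : nat) : Prop := [set: F] #= `I_n.

Record hyperfield_hom (F L : hyperfield) (f : F -> L) : Prop := {
  hf_hom0 : f (hf_zero F) = hf_zero L;
  hf_hom1 : f (hf_one F) = hf_one L;
  hf_homM : forall x y, f (hf_mul x y) = hf_mul (f x) (f y);
  hf_homD : forall x y, f @` hf_add x y `<=` hf_add (f x) (f y) }.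

Definition hyperfield_iso (F L : hyperfield) (f : F -> L) : Prop :=
  hyperfield_hom f /\
  exists g : L -> F, [/\ cancel f g, cancel g f & hyperfield_hom g].

Definition isomorphic (F L : hyperfield) : Prop :=
  exists f : F -> L, hyperfield_iso f.

(* Main.v *)
(* Let 0, 1, a be the elements.  Then a * a = 1, so by distributivity the
   addition is determined by A = 1 + 1 and B = 1 + a, and a B = B.
   - If -1 = 1, then 0 is in A but not in B, hence B = {1, a}; reversibility
     turns 1 in 1 + a into a in 1 + 1, so A is {0, a} or {0, 1, a}.
   - If -1 = a, then 0 is in B but not in A, so B is {0} or {0, 1, a};
     reversibility gives 1 in A iff 1 in B, so (A, B) is ({a}, {0}),
     ({1}, {0, 1, a}) or ({1, a}, {0, 1, a}).
   An isomorphism fixes 0 and 1, hence a, so the five pairs are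
   non-isomorphic; that they are hyperfields is a finite verification. *)
Require Import Defs.
From mathcomp Require Import all_boot.
From mathcomp Require Import boolp classical_sets cardinality.

Set Implicit Arguments.
Unset Strict Implicit.
Unset Printing Implicit Defensive.

(* [None], [Some false] and [Some true] encode 0, 1 and a. *)
Notation trit := (option bool).
Notation t0 := (None : trit).
Notation t1 := (Some false : trit).
Notation ta := (Some true : trit).

Definition trits : seq trit := [:: t0; t1; ta].

(** Turns a quantifier over the three elements into a Boolean computation, so that the axioms can be
    decided by case analysis. *)
Lemma has_tritsP (P : pred trit) : reflect (exists x, P x) (has P trits).
Proof.
apply: (iffP hasP) => [[x _ Px]|[x Px]]; first by exists x.
by exists x => //; case: x {Px} => [[]|].
Qed.

(** The nonzero elements form the group of order 2, written as [bool] under [addb] with unit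
    [false]. *)
Definition tmul (x y : trit) : trit :=
  if x is Some s then omap (addb s) y else t0.

(* As a * a = 1, membership of z in a A is tested as a z \in A. *)
Definition table (A B : seq trit) (x y z : trit) : bool :=
  match x, y with
  | None, _ => z == y
  | _, None => z == x
  | Some s, Some t => if s == t then tmul x z \in A else z \in B
  end.

Definition tables : seq (seq trit * seq trit) :=
  [:: ([:: t0; ta], [:: t1; ta]);
      ([:: t0; t1; ta], [:: t1; ta]);
      ([:: ta], [:: t0]);
      ([:: t1], [:: t0; t1; ta]);
      ([:: t1; ta], [:: t0; t1; ta])].

Definition tadd (i : nat) : trit -> trit -> trit -> bool :=
  let AB := nth ([::], [::]) tables i in table AB.1 AB.2.

Definition tsum (i : nat) : hyperop trit := fun x y z => tadd i x y z.

Lemma tadd_has i x y : i < 5 -> has (tadd i x y) trits.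
Proof. by move: i x y => [|[|[|[|[|//]]]]] [[]|] [[]|]. Qed.

Lemma taddC i x y z : i < 5 -> tadd i x y z = tadd i y x z.
Proof. by move: i x y z => [|[|[|[|[|//]]]]] [[]|] [[]|] [[]|]. Qed.

Lemma taddA i x y z w : i < 5 ->
  has (fun t => tadd i y z t && tadd i x t w) trits =
  has (fun t => tadd i x y t && tadd i t z w) trits.
Proof.
by move: i x y z w => [|[|[|[|[|//]]]]] [[]|] [[]|] [[]|] [[]|].
Qed.

(** In the first two entries of [tables] 0 lies in 1 + 1, so -1 = 1; in the other three it lies in 1
    + a, so -1 = a and the opposite is multiplication by a. *)
Definition topp (i : nat) (x : trit) : trit :=
  if i < 2 then x else tmul ta x.

Lemma tadd_opp i x y : i < 5 -> tadd i x y t0 = (y == topp i x).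
Proof. by move: i x y => [|[|[|[|[|//]]]]] [[]|] [[]|]. Qed.

Lemma tadd_rev i x y z : i < 5 -> tadd i y z x = tadd i x (topp i y) z.
Proof. by move: i x y z => [|[|[|[|[|//]]]]] [[]|] [[]|] [[]|]. Qed.

Lemma tadd0 i x z : tadd i t0 x z = (z == x).
Proof. by []. Qed.

Lemma tmulC : commutative tmul.
Proof. by move=> [[]|] [[]|]. Qed.

Lemma tmulDr i a x y z : i < 5 ->
  has (fun s => tadd i x y s && (tmul a s == z)) trits =
  tadd i (tmul a x) (tmul a y) z.
Proof.
by move: i a x y z => [|[|[|[|[|//]]]]] [[]|] [[]|] [[]|] [[]|].
Qed.

Lemma is_hypergroup_tsum i : i < 5 -> is_hypergroup (tsum i) t0.
Proof.
move=> i5; split.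
- by move=> x y; have /has_tritsP := tadd_has x y i5.
- by move=> x y; apply/funext => z; rewrite /tsum taddC.
- move=> x y z; apply/funext => w; apply/propext.
  have := taddA x y z w i5; move/(congr1 is_true) => E; split.
  + case=> _ -> [t yzt xtw].
    have /has_tritsP[u /andP[xyu uzw]] :
        has (fun t => tadd i x y t && tadd i t z w) trits.
      by rewrite -E; apply/has_tritsP; exists t; apply/andP.
    by exists u => //; exists z.
  + case=> t xyt [_ -> tzw].
    have /has_tritsP[u /andP[yzu xuw]] :
        has (fun t => tadd i y z t && tadd i x t w) trits.
      by rewrite E; apply/has_tritsP; exists t; apply/andP.
    by exists x => //; exists u.
- move=> x; apply/funext => z; apply/propext.
  by rewrite /tsum tadd0; split=> /eqP.
- move=> x; exists (topp i x); split; first by rewrite /tsum tadd_opp.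
  by move=> y; rewrite /tsum tadd_opp // => /eqP.
- move=> x y z y'; rewrite {1}/tsum tadd_opp // => /eqP ->.
  by rewrite /tsum tadd_rev.
Qed.

Lemma is_hyperfield_tsum i : i < 5 -> is_hyperfield tmul (tsum i) t1 t0.
Proof.
move=> i5.
have DrP a x y : [set tmul a s | s in tsum i x y]%classic =
                 tsum i (tmul a x) (tmul a y).
  apply/funext => z; apply/propext; rewrite /tsum -tmulDr //; split.
    by case=> s xys <-; apply/has_tritsP; exists s; rewrite eqxx andbT.
  by case/has_tritsP => s /andP[xys /eqP <-]; exists s.
split=> //.
- split.
  + by move=> [[]|] [[]|] [[]|].
  + exact: tmulC.
  + by move=> [[]|].
  + exact: is_hypergroup_tsum.
  + by [].
  + by move=> [[]|].
  + exact: DrP.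
  + move=> a x y; rewrite [tmul x a]tmulC [tmul y a]tmulC -DrP.
    by congr image; apply/funext => s; rewrite tmulC.
- by move=> x; exists x; case: x H => [[]|].
Qed.

Definition hyperfield3 (i : 'I_5) : hyperfield :=
  Hyperfield (is_hyperfield_tsum (ltn_ord i)).

Lemma has_order_hyperfield3 i : has_order (hyperfield3 i) 3.
Proof.
apply/card_set_bijP; exists (index^~ trits); split.
- by case=> [[]|].
- by move=> [[]|] [[]|].
- by move=> [|[|[|//]]] _; [exists t0 | exists t1 | exists ta].
Qed.

(** The five sets 1 + 1 are pairwise distinct, so a few membership values tell the tables apart. *)
Lemma tadd_inj i j : i < 5 -> j < 5 ->
  (forall x y z, tadd i x y z = tadd j x y z) -> i = j.
Proof.
move=> i5 j5 E.
move: (E t1 t1 t0) (E t1 t1 t1) (E t1 t1 ta) (E t1 ta t0) => {E}.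
by move: i j i5 j5 => [|[|[|[|[|//]]]]] [|[|[|[|[|//]]]]].
Qed.

Lemma hyperfield3_iso_eq i j :
  isomorphic (hyperfield3 i) (hyperfield3 j) -> i = j.
Proof.
have fix_trit k l (f : hyperfield3 k -> hyperfield3 l) :
    injective f -> hyperfield_hom f -> f =1 id.
  move=> finj [f0 f1 _ _]; rewrite /= in f0 f1.
  case=> [[]|] //=; case E: (f ta) => [[]|] //=.
    by have := finj ta t1; rewrite f1 E => /(_ erefl).
  by have := finj ta t0; rewrite f0 E => /(_ erefl).
case=> f [fhom [g [fK gK ghom]]].
have fE := fix_trit _ _ f (can_inj fK) fhom.
have gE := fix_trit _ _ g (can_inj gK) ghom.
(* Both maps are the identity, so their two inclusions of sums combine into equality of the
   tables. *)
apply/val_inj/tadd_inj => //= x y z; apply/idP/idP => h.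
  have := hf_homD fhom (x := x) (y := y) (ex_intro2 _ _ z h erefl).
  by rewrite !fE.
have := hf_homD ghom (x := x) (y := y) (ex_intro2 _ _ z h erefl).
by rewrite !gE.
Qed.

(** Stated for a Boolean-valued addition on [trit], to be applied to the addition of any hyperfield
    of order 3 carried over to [trit]. *)
Lemma tadd_classification (b : trit -> trit -> trit -> bool) :
  (forall x y, has (b x y) trits) ->
  (forall x y z, b x y z = b y x z) ->
  (forall x z, b t0 x z = (z == x)) ->
  (forall x y z, b (tmul ta x) (tmul ta y) (tmul ta z) = b x y z) ->
  (exists y, forall y', b t1 y' t0 = (y' == y)) ->
  (forall x y z y', b y y' t0 -> b y z x = b x y' z) ->
  exists i : 'I_5, forall x y z, b x y z = tadd i x y z.
Proof.
move=> bn0 bC b0 bM [o bopp] brev.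
(* Filtering [trits] lists both sums in the fixed order 0, 1, a, so that they can be compared with
   [tables] as sequences. *)
pose A := [seq z <- trits | b t1 t1 z]; pose B := [seq z <- trits | b t1 ta z].
have tritsT z : z \in trits by case: z => [[]|].
have bE x y z : b x y z = table A B x y z.
  case: x y => [[]|] [[]|] /=; rewrite ?b0 // ?(bC (Some _) t0) ?b0 //;
    rewrite mem_filter tritsT andbT //.
  - by rewrite -bM.
  - by case: z => [[]|].
suff ABin : (A, B) \in tables.
  have ltAB : index (A, B) tables < 5 by rewrite index_mem.
  by exists (Ordinal ltAB) => x y z; rewrite /tadd /= nth_index.
have B_sym : b t1 ta t1 = b t1 ta ta by rewrite -bM bC.
have := bn0 t1 t1; have := bn0 t1 ta.
rewrite /A /B /= B_sym.
(* The opposite [o] of 1 is not 0, since 1 + 0 = {1}. *)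
have := bopp t0; rewrite bC b0 /= => o_neq0.
have := bopp t1; have := bopp ta.
(* The cases left are [o] = a, then [o] = 1; in each, reversibility, [B_sym] and nonemptiness leave
   only listed tables. *)
case: o bopp o_neq0 => [[]|] //= bopp _ e1 e2.
- have := brev t1 t1 t1 ta e1; rewrite e1 e2 B_sym.
  by case: (b t1 t1 t1); case: (b t1 t1 ta); case: (b t1 ta ta).
- have := brev t1 t1 ta t1 e2; rewrite e1 e2 B_sym.
  by case: (b t1 t1 t1); case: (b t1 t1 ta); case: (b t1 ta ta).
Qed.

Lemma order3_third (F : hyperfield) : has_order F 3 ->
  exists a : F, [/\ a <> hf_zero F, a <> hf_one F &
    forall x, [\/ x = hf_zero F, x = hf_one F | x = a]].
Proof.
case/card_set_bijP => f [flt finj fsurj].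
have inj x y : f x = f y -> x = y by apply: finj; rewrite inE.
have lt3 x : f x < 3 by exact: flt.
have neq01 : f (hf_zero F) <> f (hf_one F).
  by move/inj; apply: hyperfield_neq01 (hf_axioms F).
have [k [k3 k0 k1 kall]] : exists k, [/\ k < 3, k <> f (hf_zero F),
    k <> f (hf_one F) &
    forall m, m < 3 -> [\/ m = f (hf_zero F), m = f (hf_one F) | m = k]].
  move: (lt3 (hf_zero F)) (lt3 (hf_one F)) neq01.
  move: (f (hf_zero F)) (f (hf_one F)) => m n m3 n3 mn.
  (* As 0, 1 and 2 sum to 3, this is the index other than [m] and [n]. *)
  exists (3 - m - n).
  move: m n m3 n3 mn => [|[|[|//]]] [|[|[|//]]] //= _ _ _;
    split=> // [[|[|[|//]]]] _;
    by [apply: Or31 | apply: Or32 | apply: Or33].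
have [a _ fa] := fsurj k k3.
exists a; split; try by move=> ea; rewrite -fa ea in k0 k1.
move=> x; case: (kall (f x) (lt3 x)) => [/inj|/inj|].
- by move=> ->; apply: Or31.
- by move=> ->; apply: Or32.
- by rewrite -fa => /inj ->; apply: Or33.
Qed.

Lemma order3_iso (F : hyperfield) : has_order F 3 ->
  exists i, isomorphic F (hyperfield3 i).
Proof.
case/order3_third => a [a0 a1 Fall].
case: (hf_axioms F) => -[mA mC m1 Fgrp m0l m0r mDr _] n01 inv.
case: (Fgrp) => aN aC _ a0l aopp arev.
(* The inverse of a is not 0, since 0 and 1 differ, and not 1, since a is not 1; so it is a. *)
have aa : hf_mul a a = hf_one F.
  have [y] := inv a a0; case: (Fall y) => ->; last by [].
    by rewrite m0r => /n01.
  by rewrite mC m1 => /a1.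
pose e (t : trit) : F :=
  match t with None => hf_zero F | Some s => if s then a else hf_one F end.
have eM x y : e (tmul x y) = hf_mul (e x) (e y).
  by case: x y => [[]|] [[]|]; rewrite /= ?m0l ?m0r ?m1 // ?aa // mC m1.
have einj : injective e.
  by move=> [[]|] [[]|] //= E;
    [case: a1 | case: n01 | case: a0]; rewrite E.
have esurj x : {t | e t = x}.
  by apply: cid; case: (Fall x) => ->; [exists t0 | exists t1 | exists ta].
pose d x := sval (esurj x).
have dK : cancel d e by move=> x; apply: svalP (esurj x).
have eK : cancel e d by move=> t; apply: einj; rewrite dK.
pose b x y z := `[< hf_add (e x) (e y) (e z) >].
have [||||||i bE] := @tadd_classification b.
- by move=> x y; apply/has_tritsP; have [z xyz] := aN (e x) (e y);
    exists (d z); apply/asboolP; rewrite dK.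
- by move=> x y z; rewrite /b aC.
- move=> x z; rewrite /b /= a0l; apply/asboolP/eqP => [/einj|->] //.
- move=> x y z; apply/asboolP/asboolP; rewrite !eM -mDr.
    (* Cancelling a, which is its own inverse, pulls membership in the multiplied sum back to the
       original one. *)
    have a_inj : injective (hf_mul (e ta)).
      by apply: (can_inj (g := hf_mul a)) => w; rewrite mA /= aa m1.
    by case=> s xys /a_inj <-.
  by move=> xyz; exists (e z).
- have [y [oy uy]] := aopp (e t1); exists (d y) => y'.
  apply/asboolP/eqP => [/uy ->|->]; first by rewrite eK.
  by rewrite dK.
- move=> x y z y' /asboolP yy'; have E := arev (e x) (e y) (e z) (e y') yy'.
  by apply/asboolP/asboolP => /E.
(* The forward direction makes [d] compatible with sums, the backward one its inverse [e]. *)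
have homE x y z : hf_add x y z <-> tadd i (d x) (d y) (d z).
  by rewrite -bE /b !dK; split=> /asboolP.
exists i, d; split; last first.
  exists e; split=> //; split=> //= x y _ [z xyz <-].
  by apply/homE; rewrite !eK.
split.
- by rewrite -[hf_zero F]/(e t0) eK.
- by rewrite -[hf_one F]/(e t1) eK.
- by move=> x y; apply: einj; rewrite eM !dK.
- by move=> x y _ [z xyz <-]; apply/homE.
Qed.

Theorem proposition2p4 :
  exists H : 'I_5 -> hyperfield,
    [/\ forall i, has_order (H i) 3,
        forall i j, isomorphic (H i) (H j) -> i = j
      & forall F : hyperfield, has_order F 3 -> exists i, isomorphic F (H i)].
Proof.
exists hyperfield3; split.
- exact: has_order_hyperfield3.
- exact: hyperfield3_iso_eq.
- exact: order3_iso.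
Qed.
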